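(* Let $d\geq 3$. Let $f\in\mathbb{R}[x,y]_{2d}$ be positive on $\mathbb{P}^1(\mathbb{R})$. If $F\subseteq\mathrm{Gram}(f)$ is a face of rank $d$, then $\dim(F)<\binom{d-1}{2}$. In other words: if $f\in\mathbb{R}[x,y]_{2d}$ is a nonnegative binary form and $\mathrm{Gram}(f)$ contains a face $F$ of dimension $\binom{d-1}{2}$, then already $F=\mathrm{Gram}(f)$ (and $f$ has a real root, i.e. a zero in $\mathbb{P}^1(\mathbb{R})$).
   Context: $\mathbb{R}[x,y]_m$ denotes the space of real binary forms of degree $m$ (together with $0$). A form $f\in\mathbb{R}[x,y]_{2d}$ is nonnegative if $f(a,b)\ge 0$ for all $(a,b)\in\mathbb{R}^2$, and positive on $\mathbb{P}^1(\mathbb{R})$ if $f(a,b)>0$ for all $(a,b)\in\mathbb{R}^2\setminus\{0\}$. Let $V=\mathbb{R}[x,y]_d$, let $\mathsf{S}_2V\subseteq V\otimes V$ be the space of symmetric tensors (invariant under $p\otimes q\mapsto q\otimes p$) and let $\mu:\mathsf{S}_2V\to\mathbb{R}[x,y]_{2d}$ be the linear map induced by $p\otimes q\mapsto pq$. Every $\theta\in\mathsf{S}_2V$ can be written as $\theta=\sum_{i=1}^r\epsilon_i\,p_i\otimes p_i$ with $\epsilon_i=\pm1$ and $p_1,\dots,p_r\in V$ linearly independent; then $\mathrm{im}(\theta)=\mathrm{span}(p_1,\dots,p_r)$, $\mathrm{rk}(\theta)=r$, and $\theta$ is positive semidefinite (psd) if all $\epsilon_i=1$. The (symmetric) Gram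 spectrahedron is $\mathrm{Gram}(f)=\{\theta\in\mathsf{S}_2V:\theta\text{ psd},\ \mu(\theta)=f\}$. For a nonempty face $F$ of $\mathrm{Gram}(f)$ put $\mathscr{U}(F)=\sum_{\theta\in F}\mathrm{im}(\theta)\subseteq V$; the rank of $F$ is $\mathrm{rk}(F)=\dim\mathscr{U}(F)$ (this equals $\mathrm{rk}(\theta)$ for every $\theta$ in the relative interior of $F$). *)

(* Defs.v *)
From HB Require Import structures.
From mathcomp Require Import all_boot all_order all_algebra.
From mathcomp Require Import mpoly.
From mathcomp Require Import boolp classical_sets reals convex.

Set Implicit Arguments.
Unset Strict Implicit.
Unset Printing Implicit Defensive.

Import Order.TTheory GRing.Theory Num.Theory.

Local Open Scope classical_set_scope.
Local Open Scope ring_scope.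

Section SpanOfSet.
Variables (K : fieldType) (V : vectType K).
Implicit Types (A : set V) (U W : {vspace V}).

Definition is_span A U : Prop :=
  A `<=` [set v | v \in U] /\
  forall W, A `<=` [set v | v \in W] -> (U <= W)%VS.

(* The span of an arbitrary, possibly infinite, set of vectors. *)
Definition span_set A : {vspace V} := xget 0%VS [set U | is_span A U].

Lemma span_setP A : is_span A (span_set A).
Proof.
rewrite /span_set; apply: (@xgetPex _ _ [set U | is_span A U]).
pose P n := `[< exists U, A `<=` [set v | v \in U] /\ \dim U = n >].
have exP : exists n, P n.
  by exists (\dim {:V}); apply/asboolP; exists fullv; split=> // v _; exact: memvf.
case: (ex_minnP exP) => n /asboolP[U [AU dU]] minU.
exists U; split=> // W AW.
have : (n <= \dim (U :&: W))%N.
  apply: minU; apply/asboolP; exists (U :&: W)%VS; split=> // v Av /=.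
  by rewrite memv_cap; apply/andP; split; [exact: AU|exact: AW].
rewrite -dU => le; have /eqP <- : (U :&: W == U)%VS.
  by rewrite eqEdim capvSl.
exact: capvSr.
Qed.

(* The dimension of the affine hull of [A]; it is a natural number, so that
   [affdim set0 = 0] rather than [-1]. *)
Definition affdim A : nat :=
  \dim (span_set [set v | exists x y, [/\ A x, A y & v = x - y]]).

End SpanOfSet.

(* V (x) V is modelled by Hom(V^*, V), with p (x) q sending a linear form l to
   (l p) q; the image of a tensor is then [limg]. *)
Notation tens2 V := 'Hom('Hom(V, _^o), V).

Section Tensors.
Variables (K : fieldType) (V : vectType K).

Definition tens (p q : V) : tens2 V :=
  linfun (fun l : 'Hom(V, K^o) => (l p : K) *: q).

Definition dual_basis (i : 'I_(\dim {:V})) : 'Hom(V, K^o) :=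
  linfun (coord (vbasis {:V}) i : V -> K^o).

(* The linear map V (x) V -> W induced by a bilinear map [B] on V x V. *)
Definition tens_lift (W : lmodType K) (B : V -> V -> W) (t : tens2 V) : W :=
  \sum_(i < \dim {:V}) B (vbasis {:V})`_i (t (dual_basis i)).

Definition tens_swap : tens2 V -> tens2 V := tens_lift (fun p q => tens q p).

Lemma tensE p q l : tens p q l = (l p : K) *: q.
Proof.
pose f l : V := ((l : 'Hom(V, K^o)) p : K) *: q.
have lf : linear f.
  by move=> a u v; rewrite /f add_lfunE scale_lfunE scalerDl scalerA.
pose g := GRing.isLinear.Build _ _ _ _ f lf.
pose F : {linear 'Hom(V, K^o) -> V} := HB.pack f g.
exact: (lfunE F l).
Qed.

Lemma dual_basisE i v : dual_basis i v = coord (vbasis {:V}) i v.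
Proof. by rewrite /dual_basis lfunE. Qed.

Lemma sum_dual_basis v : \sum_(i < \dim {:V}) (dual_basis i v : K) *: (vbasis {:V})`_i = v.
Proof.
rewrite [RHS](coord_vbasis (memvf v)).
by apply: eq_bigr => i _; rewrite dual_basisE.
Qed.

Lemma tens_lift_tens (W : lmodType K) (B : V -> V -> W) p q :
  (forall u, linear (B u)) -> (forall v, linear (B ^~ v)) ->
  tens_lift B (tens p q) = B p q.
Proof.
move=> Br Bl; rewrite /tens_lift.
pose gl := GRing.isLinear.Build _ _ _ _ (B ^~ q) (Bl q).
pose Fl : {linear V -> W} := HB.pack (B ^~ q) gl.
transitivity (Fl p) => //; rewrite -[in RHS](sum_dual_basis p) linear_sum.
apply: eq_bigr => i _; rewrite linearZ /= tensE.
pose gr := GRing.isLinear.Build _ _ _ _ _ (Br (vbasis {:V})`_i).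
pose Fr : {linear V -> W} := HB.pack (B (vbasis {:V})`_i) gr.
exact: (linearZZ Fr).
Qed.

Lemma tens_lift_linear (W : lmodType K) (B : V -> V -> W) :
  (forall u, linear (B u)) -> linear (tens_lift B).
Proof.
move=> Br a t t'; rewrite /tens_lift scaler_sumr -big_split /=.
by apply: eq_bigr => i _; rewrite add_lfunE scale_lfunE Br.
Qed.

Lemma tens_sum (t : tens2 V) :
  t = \sum_(i < \dim {:V}) tens (vbasis {:V})`_i (t (dual_basis i)).
Proof.
apply/lfunP => l; rewrite sum_lfunE.
have {1}-> : l = \sum_(i < \dim {:V}) (l (vbasis {:V})`_i : K) *: dual_basis i.
  apply/lfunP => v; rewrite sum_lfunE -[in LHS](sum_dual_basis v) linear_sum.
  by apply: eq_bigr => i _; rewrite linearZ scale_lfunE [LHS]mulrC.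
by rewrite linear_sum; apply: eq_bigr => i _; rewrite linearZ tensE.
Qed.

Lemma tens_linearl q : linear (tens ^~ q).
Proof.
move=> a u v; apply/lfunP => l.
by rewrite add_lfunE scale_lfunE !tensE linearP scalerDl scalerA.
Qed.

Lemma tens_linearr p : linear (tens p).
Proof.
move=> a u v; apply/lfunP => l; rewrite add_lfunE scale_lfunE !tensE.
by rewrite scalerDr !scalerA mulrC.
Qed.

Lemma tens_swap_tens p q : tens_swap (tens p q) = tens q p.
Proof.
by apply: tens_lift_tens => [u|v]; [exact: tens_linearl|exact: tens_linearr].
Qed.

Definition symmetric_tens (t : tens2 V) : Prop := tens_swap t = t.

Definition psd_tens (t : tens2 V) : Prop :=
  exists (r : nat) (p : r.-tuple V),
    free p /\ t = \sum_(i < r) tens p`_i p`_i.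

Lemma limg_tens (r : nat) (e : 'I_r -> bool) (p : r.-tuple V) : free p ->
  limg (\sum_(i < r) (-1) ^+ e i *: tens p`_i p`_i) = <<p>>%VS.
Proof.
move=> fp; set t := \sum_(i < r) _.
have tE l : t l = \sum_(i < r) ((-1) ^+ e i * (l p`_i : K)) *: p`_i.
  rewrite sum_lfunE; apply: eq_bigr => i _.
  by rewrite scale_lfunE tensE scalerA.
apply/eqP; rewrite eqEsubv; apply/andP; split.
  apply/subvP => _ /memv_imgP[l _ ->]; rewrite tE.
  by apply: memv_suml => i _; rewrite memvZ// memv_span// mem_nth// size_tuple.
apply/span_subvP => _ /(nthP 0)[j jr <-]; rewrite size_tuple in jr.
pose j' := Ordinal jr.
have -> : p`_j = t ((-1) ^+ e j' *: linfun (coord p j' : V -> K^o)).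
  rewrite tE (bigD1 j')//= big1 ?addr0 => [|i ij]; last first.
    by rewrite scale_lfunE lfunE /= coord_free// (negbTE ij) scaler0 mulr0 scale0r.
  rewrite scale_lfunE lfunE /=; have /= -> := coord_free j' j' fp.
  rewrite eqxx [_ *: true%:R]mulr1.
  by rewrite -expr2 sqrr_sign scale1r.
exact: memv_img (memvf _).
Qed.

End Tensors.

(* [C] is meant to be convex; [set0] counts as a face. *)
Definition face (R : realType) (E : lmodType R) (C F : set E) : Prop :=
  [/\ F `<=` C,
      convex_set (F : set (convex_lmodType E)) &
      forall (x y : E) (s : R), C x -> C y -> 0 < s < 1 ->
        F (s *: x + (1 - s) *: y) -> F x /\ F y].

Notation binary_form R m := (dhomog 2 R m).

Section BinaryForms.
Variable R : realType.

Definition feval m (f : binary_form R m) (a b : R) : R :=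
  (mpoly_of_dhomog f).@[tnth [tuple a; b]].

Definition nonnegative m (f : binary_form R m) : Prop := forall a b, 0 <= feval f a b.

Definition positive_on_P1 m (f : binary_form R m) : Prop :=
  forall a b, (a, b) != (0, 0) -> 0 < feval f a b.

Definition has_real_root m (f : binary_form R m) : Prop :=
  exists a b, (a, b) != (0, 0) /\ feval f a b = 0.

Variable d : nat.

Fact form_mul_subproof (p q : binary_form R d) :
  (mpoly_of_dhomog p * mpoly_of_dhomog q) \is (2 * d).-homog.
Proof. by rewrite mul2n -addnn; apply: dhomogM; apply: dhomog_is_dhomog. Qed.

Definition form_mul (p q : binary_form R d) : binary_form R (2 * d) :=
  DHomog (form_mul_subproof p q).

Definition mu : tens2 (binary_form R d) -> binary_form R (2 * d) := tens_lift form_mul.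

Lemma mu_tens (p q : binary_form R d) : mu (tens p q) = form_mul p q.
Proof.
apply: tens_lift_tens => [u a v w|v a u w]; apply: val_inj => /=.
  by rewrite mulrDr scalerAr.
by rewrite mulrDl scalerAl.
Qed.

Definition Gram (f : binary_form R (2 * d)) : set (tens2 (binary_form R d)) :=
  [set t | [/\ symmetric_tens t, psd_tens t & mu t = f]].

(* The sum of the images of all tensors in [F]. *)
Definition face_space (F : set (tens2 (binary_form R d))) : {vspace binary_form R d} :=
  span_set (\bigcup_(t in F) [set v | v \in limg t]).

Definition face_rank (F : set (tens2 (binary_form R d))) : nat := \dim (face_space F).

End BinaryForms.

(* Main.v *)
Require Import Defs.
From HB Require Import structures.
From mathcomp Require Import all_boot all_order all_algebra.
From mathcomp Require Import mpoly ring lra zify.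
From mathcomp Require Import boolp classical_sets reals interval_inference convex.

(** If [F] is a face whose space [U] is proper, its directions are symmetric
    tensors [t] with [mu t = 0], killed by every functional [l] vanishing on
    [U].  On symmetric tensors, [t |-> (mu t, t l)] takes values in a space of
    dimension [3 d + 2]; a functional vanishing on its image is a pair of
    sequences [h], [m] with [h (i + j) = l i * m j + m i * l j], so a Hankel
    matrix which is the symmetrised product of [l] and [m].  If such pairs span
    at least a plane, solving the Hankel equations forces [l] to be a multiple
    of evaluation at a real point.  Hence [dim F >= 'C(d - 1, 2)] forces every
    functional vanishing on [U] to be an evaluation; since the sum of two
    non-proportional evaluations is not one, [U] is the set of all forms
    vanishing at one real point [P], and a sum of squares of elements of [U]
    vanishes at [P].
    Conversely, if [f] vanishes at [P], every tensor of [Gram f] has its image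
    in [U], and a face containing a tensor of maximal image is all of
    [Gram f].  If [U] is the whole space, [Gram f] has dimension at least
    ['C(d, 2) > 'C(d - 1, 2)]. *)

Set Implicit Arguments.
Unset Strict Implicit.
Unset Printing Implicit Defensive.

Import Order.TTheory GRing.Theory Num.Theory.

(** * Separation by linear functionals, and symmetric tensors as bilinear forms *)

Section Functionals.
Local Open Scope ring_scope.
Variables (K : fieldType) (V : vectType K).
Implicit Types (W : {vspace V}) (v w : V) (k l : 'Hom(V, K^o)) (t : tens2 V).

Lemma separating_functional W v : v \notin W ->
  exists l, l v = 1 /\ forall w, w \in W -> l w = 0.
Proof.
move=> vW; pose X := [tuple of v :: vbasis W].
have fX : free X.
  by rewrite free_cons (span_basis (vbasisP W)) vW (basis_free (vbasisP W)).
exists (linfun (coord X ord0 : V -> K^o)); split=> [|w wW]; rewrite lfunE /=.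
  by have := coord_free ord0 ord0 fX; rewrite /= => ->.
rewrite [w in LHS](coord_vbasis wW) linear_sum big1 // => i _.
rewrite linearZ /=.
by have /= -> := coord_free (lift ord0 i) ord0 fX; rewrite mulr0.
Qed.

Lemma exists_notin_vspace W : (\dim W < \dim {:V})%N -> exists v, v \notin W.
Proof.
rewrite ltnNge => dW; apply: contrapT => nW; move/negP: dW; apply.
apply: dimvS; apply/subvP => v _; apply: contraT => vW.
by exfalso; apply: nW; exists v.
Qed.

Lemma functional_eq v w : (forall l, l v = l w) -> v = w.
Proof.
move=> vw; apply/eqP; rewrite -subr_eq0; apply/eqP/eqP.
apply: contraT => vw0.
have [|l [lv _]] := @separating_functional 0%VS (v - w); first by rewrite memv0.
by move: lv; rewrite linearB /= vw subrr => /esym/eqP; rewrite oner_eq0.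
Qed.

Lemma subv_functional (U W : {vspace V}) :
  (forall l, (forall w, w \in W -> l w = 0) -> forall u, u \in U -> l u = 0) ->
  (U <= W)%VS.
Proof.
move=> h; apply/subvP => u uU; apply: contraT => /separating_functional[l [lu lW]].
by move: lu; rewrite (h l) // => /esym/eqP; rewrite oner_eq0.
Qed.

Lemma functional_sum k :
  k = \sum_(i < \dim {:V}) (k (vbasis {:V})`_i : K) *: dual_basis i.
Proof.
apply/lfunP => v; rewrite sum_lfunE -[in LHS](sum_dual_basis v) linear_sum.
by apply: eq_bigr => i _; rewrite linearZ scale_lfunE [LHS]mulrC.
Qed.

Lemma tens_swapE t k l : k (tens_swap t l) = l (t k).
Proof.
rewrite /tens_swap /tens_lift sum_lfunE linear_sum [in RHS](functional_sum k).
rewrite !linear_sum; apply: eq_bigr => i _; rewrite tensE !linearZ /=.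
by rewrite [LHS]mulrC.
Qed.

Lemma symmetric_tensP t : symmetric_tens t <-> forall k l, k (t l) = l (t k).
Proof.
split=> [tt k l|h]; first by rewrite -[in LHS]tt tens_swapE.
by apply/lfunP => l; apply: functional_eq => k; rewrite tens_swapE h.
Qed.

End Functionals.

(** * Functionals annihilating a subspace of a product *)

Section ProductFunctionals.
Local Open Scope ring_scope.
Variables (K : fieldType) (A B : vectType K).

Lemma memv_lker_linfun (f : {linear A -> B}) v : (v \in lker (linfun f)) = (f v == 0).
Proof. by rewrite memv_ker lfunE. Qed.

(** Codimension at least two leaves room to add [(0, w)] to [W] and still have a vector outside; a
    functional separating that vector splits into [k] and [l]. *)
Lemma annihilating_pair (W : {vspace (A * B)%type}) (w : B) :
  (\dim W + 1 < \dim {:A} + \dim {:B})%N ->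
  exists (k : 'Hom(A, K^o)) (l : 'Hom(B, K^o)),
    [/\ forall u, u \in W -> (k u.1 : K) + l u.2 = 0, l w = 0 &
        ~ (k = 0 /\ l = 0)].
Proof.
move=> dW.
have [|v vW] := @exists_notin_vspace _ _ (W + <[(0%R, w)]>)%VS.
  rewrite (_ : \dim {: (A * B)%type} = \dim {:A} + \dim {:B})%N; last by rewrite !dimvf.
  apply: leq_ltn_trans dW; apply: leq_trans (dimv_add_leqif _ _).1 _.
  by rewrite leq_add2l dim_vline; case: (_ != 0).
have [L [Lv LW]] := separating_functional vW.
have lin1 : linear (fun p : A => L (p, 0) : K^o).
  by move=> a p q; rewrite -linearP; congr (L _); congr pair; rewrite /= scaler0 addr0.
have lin2 : linear (fun p : B => L (0, p) : K^o).
  by move=> a p q; rewrite -linearP; congr (L _); congr pair; rewrite /= scaler0 addr0.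
pose L1 : {linear A -> K^o} :=
  HB.pack (fun p : A => L (p, 0) : K^o) (GRing.isLinear.Build _ _ _ _ _ lin1).
pose L2 : {linear B -> K^o} :=
  HB.pack (fun p : B => L (0, p) : K^o) (GRing.isLinear.Build _ _ _ _ _ lin2).
have LE u : (linfun L1 u.1 : K) + linfun L2 u.2 = L u.
  rewrite !lfunE /=; transitivity (L ((u.1, 0) + (0, u.2))); first by rewrite linearD.
  by congr (L _); case: u => x y; congr pair; rewrite /= ?addr0 ?add0r.
exists (linfun L1), (linfun L2); split=> [u uW||[k0 l0]].
- by rewrite LE LW// (subvP (addvSl _ _)).
- by rewrite lfunE /= LW// (subvP (addvSr _ _)) ?memv_line.
by move: Lv; rewrite -LE k0 l0 !zero_lfunE addr0 => /esym/eqP; rewrite oner_eq0.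
Qed.

End ProductFunctionals.

Section JointKernel.
Local Open Scope ring_scope.
Variables (K : fieldType) (T A B : vectType K).

Lemma joint_kernel_annihilator (f : {linear T -> A}) (g : {linear T -> B})
    (S : {vspace T}) (w : B) (n : nat) :
  (\dim S <= \dim (S :&: (lker (linfun f) :&: lker (linfun g)))%VS + n)%N ->
  (n + 1 < \dim {:A} + \dim {:B})%N ->
  exists (k : 'Hom(A, K^o)) (l : 'Hom(B, K^o)),
    [/\ forall u, u \in S -> (k (f u) : K) + l (g u) = 0, l w = 0 &
        ~ (k = 0 /\ l = 0)].
Proof.
move=> dS dn.
have lin : linear (fun u => (f u, g u) : A * B).
  by move=> a u v; rewrite !linearP.
pose fg : {linear T -> (A * B)%type} :=
  HB.pack (fun u => (f u, g u) : A * B) (GRing.isLinear.Build _ _ _ _ _ lin).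
have kE : lker (linfun fg) = (lker (linfun f) :&: lker (linfun g))%VS.
  by apply/vspaceP => u; rewrite memv_cap !memv_lker_linfun.
have [|k [l [kl lw nz]]] := @annihilating_pair _ _ _ (linfun fg @: S)%VS w.
  apply: leq_ltn_trans dn; rewrite leq_add2r.
  rewrite -(leq_add2l (\dim (S :&: lker (linfun fg)))) limg_ker_dim.
  by apply: leq_trans dS _; rewrite kE.
exists k, l; split=> // u uS.
by have := kl _ (memv_img (linfun fg) uS); rewrite lfunE.
Qed.

End JointKernel.

(** * Positive semidefinite tensors *)

Section PsdTensors.
Local Open Scope ring_scope.
Variables (R : realType) (V : vectType R).
Implicit Types (W : {vspace V}) (v w : V) (k l : 'Hom(V, R^o)) (t : tens2 V).

Lemma limg_psd r (p : r.-tuple V) : free p ->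
  limg (\sum_(i < r) tens p`_i p`_i) = <<p>>%VS.
Proof.
move=> fp; rewrite -(limg_tens (fun=> false) fp); congr (limg _).
by apply: eq_bigr => i _; rewrite expr0 scale1r.
Qed.

Lemma sum_squares_form r (p : r.-tuple V) l :
  l ((\sum_(i < r) tens p`_i p`_i) l) = \sum_(i < r) (l p`_i : R) ^+ 2.
Proof.
rewrite sum_lfunE linear_sum; apply: eq_bigr => i _.
by rewrite tensE linearZ /= expr2.
Qed.

Lemma psd_ge0 t l : psd_tens t -> 0 <= (l (t l) : R).
Proof.
by move=> [r [p [_ ->]]]; rewrite sum_squares_form sumr_ge0// => i _; rewrite sqr_ge0.
Qed.

Lemma psd_isotropic t l : psd_tens t -> l (t l) = 0 ->
  forall v, v \in limg t -> l v = 0.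
Proof.
move=> [r [p [fp ->]]]; rewrite sum_squares_form limg_psd// => s0 v vp.
have lp (i : 'I_r) : l p`_i = 0.
  apply/eqP; rewrite -sqrf_eq0; apply/eqP.
  by apply: (psumr_eq0P _ s0) => // j _; rewrite sqr_ge0.
rewrite (coord_span vp) linear_sum big1// => i _.
by rewrite linearZ /= lp scaler0.
Qed.

(* A step of Gram-Schmidt: if [l (t l) > 0], subtracting [tens p p] with
   [p = t l / sqrt (l (t l))] leaves a nonnegative form with [p] outside its
   image. *)
Lemma psd_tensP t : symmetric_tens t -> (forall l, 0 <= (l (t l) : R)) -> psd_tens t.
Proof.
have [n] := ubnP (\dim (limg t)); elim: n t => // n IH t dt st t0.
have sE := (symmetric_tensP t).1 st.
have [|] := pselect (exists l, l (t l) <> 0); last first.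
  (* All diagonal values vanish, so [t = 0] by polarisation. *)
  move=> nl; exists 0%N, [tuple]; split; first by rewrite nil_free.
  rewrite big_ord0; apply/lfunP => l; apply: functional_eq => k.
  have z (m : 'Hom(V, R^o)) : (m (t m) : R) = 0.
    by apply/eqP; apply: contrapT => h; apply: nl; exists m; apply/eqP/negP.
  have := z (k + l); rewrite add_lfunE !linearD /= !z sE.
  rewrite zero_lfunE linear0 add0r addr0 => /eqP; rewrite -mulr2n mulrn_eq0 /=.
  by move/eqP.
move=> [l lt0]; set a := (l (t l) : R).
have a0 : 0 < a by rewrite lt_def t0 andbT; apply/eqP.
pose p := (Num.sqrt a)^-1 *: t l.
have pE k : (k p : R) = (Num.sqrt a)^-1 * (k (t l) : R) by rewrite linearZ.
have ppE k (m : 'Hom(V, R^o)) : ((k p : R) * (m p : R)) = a^-1 * ((k (t l) : R) * (m (t l) : R)).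
  by rewrite !pE mulrACA -invfM -expr2 sqr_sqrtr// ltW.
pose t' := t - tens p p.
have t'E k (m : 'Hom(V, R^o)) : k (t' m) = (k (t m) : R) - (k p : R) * (m p : R).
  by rewrite add_lfunE opp_lfunE tensE linearB /= linearZ /= mulrC.
have t'l : t' l = 0.
  apply: functional_eq => k; rewrite t'E ppE linear0.
  by rewrite (mulrC (k (t l) : R)) mulKf ?subrr// gt_eqF.
have st' : symmetric_tens t'.
  by apply/symmetric_tensP => k m; rewrite !t'E sE [X in _ - X]mulrC.
have t'0 (m : 'Hom(V, R^o)) : 0 <= (m (t' m) : R).
  (* The value of [t'] at [m] is that of [t] at the component of [m] orthogonal to [l]. *)
  have := t0 (m - ((m (t l) : R) / a) *: l); set c := _ / a.
  suff -> : ((m - c *: l) (t (m - c *: l)) : R) = (m (t' m) : R) by [].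
  rewrite t'E ppE !(add_lfunE, opp_lfunE, scale_lfunE) !(linearB, linearZ) /=.
  rewrite (sE l m) -/a /c; set b := (m (t l) : R); set e := (m (t m) : R).
  rewrite /GRing.scale /=.
  have : a != 0 by rewrite gt_eqF.
  by move=> ?; field.
have pt : p \in limg t by rewrite memvZ// memv_img// memvf.
have lim' : (limg t' <= limg t)%VS.
  apply/subvP => _ /memv_imgP[m _ ->].
  by rewrite add_lfunE opp_lfunE tensE memvB// ?memvZ// memv_img// memvf.
have pt' : p \notin limg t'.
  apply/negP => /memv_imgP[m _ pm].
  have : l p = 0 by rewrite pm ((symmetric_tensP t').1 st') t'l linear0.
  rewrite pE -/a => /eqP; rewrite mulf_eq0 invr_eq0 sqrtr_eq0 leNgt a0 /=.
  by rewrite gt_eqF.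
have [|r [q [fq qt']]] := IH t' _ st' t'0.
  rewrite ltnS in dt; apply: leq_trans dt.
  rewrite ltn_neqAle dimvS// andbT; apply: contra pt' => /eqP dd.
  by have /eqP-> : limg t' == limg t by rewrite eqEdim lim' dd leqnn.
exists r.+1, [tuple of p :: q]; split.
  by rewrite free_cons fq andbT -(limg_psd fq) -qt'.
by rewrite big_ord_recl /= -qt' /t' addrC subrK.
Qed.

(** A functional vanishing on the image of the combination is isotropic for it, hence for both
    nonnegative summands. *)
Lemma limg_psd_comb (a b : R) t t' : 0 < a -> 0 < b ->
  psd_tens t -> psd_tens t' -> psd_tens (a *: t + b *: t') ->
  (limg t <= limg (a *: t + b *: t')%R)%VS /\ (limg t' <= limg (a *: t + b *: t')%R)%VS.
Proof.
move=> a0 b0 pt pt' pm.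
have iso l : (forall w, w \in limg (a *: t + b *: t') -> l w = 0) ->
    l (t l) = 0 /\ l (t' l) = 0.
  move=> l0; have : (l ((a *: t + b *: t') l) : R) = 0.
    by apply: l0; rewrite memv_img ?memvf.
  rewrite add_lfunE !scale_lfunE linearD !linearZ /= /GRing.scale /= => /eqP.
  rewrite paddr_eq0 ?mulr_ge0 ?psd_ge0 ?ltW// !mulf_eq0 (gt_eqF a0) (gt_eqF b0) /=.
  by move=> /andP[/eqP ? /eqP ?].
split; apply: subv_functional => l /iso[lt lt']; exact: psd_isotropic.
Qed.

(** On a basis [p] of the image of [t], the form [t] is a sum of squares; it dominates [u] up to the
    sum [C] of the absolute values of the coefficients of [u]. *)
Lemma psd_perturb t u : psd_tens t -> symmetric_tens t -> symmetric_tens u ->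
  (limg u <= limg t)%VS -> exists2 e : R, 0 < e & psd_tens (t + e *: u).
Proof.
move=> [r [p [fp tp]]] st su ut.
have uE := (symmetric_tensP u).1 su.
have {}ut : (limg u <= <<p>>)%VS by rewrite -(limg_psd fp) -tp.
pose e (i : 'I_r) : 'Hom(V, R^o) := linfun (coord p i : V -> R^o).
have eE i v : e i v = coord p i v by rewrite lfunE.
have uk k l : k (u l) = \sum_(i < r) (k p`_i : R) * (e i (u l) : R).
  have ul : u l \in <<p>>%VS by apply: (subvP ut); rewrite memv_img ?memvf.
  rewrite [u l in LHS](coord_span ul) linear_sum; apply: eq_bigr => i _.
  by rewrite linearZ /= [LHS]mulrC eE.
pose C := \sum_(i < r) \sum_(j < r) `|e i (u (e j)) : R|.
have C0 : 0 <= C by rewrite sumr_ge0// => i _; rewrite sumr_ge0.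
have bound l : `|l (u l) : R| <= C * (l (t l) : R).
  rewrite uk tp sum_squares_form /C mulr_suml.
  apply: le_trans (ler_norm_sum _ _ _) _; apply: ler_sum => i _.
  rewrite uE uk mulr_sumr mulr_suml.
  apply: le_trans (ler_norm_sum _ _ _) _; apply: ler_sum => j _.
  rewrite (uE (e j)) mulrA normrM mulrC ler_wpM2l//.
  have sq (i' : 'I_r) : (l p`_i' : R) ^+ 2 <= \sum_(i < r) (l p`_i : R) ^+ 2.
    by rewrite (bigD1 i') //= lerDl sumr_ge0// => ? _; rewrite sqr_ge0.
  rewrite ler_norml; have := sq i; have := sq j.
  move: (\sum_(_ < _) _) => S hj hi.
  have := sqr_ge0 ((l p`_i : R) + (l p`_j : R)).
  have := sqr_ge0 ((l p`_i : R) - (l p`_j : R)).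
  move: hi hj; move: (l p`_i : R) (l p`_j : R) => a b.
  by move=> *; apply/andP; split; nra.
(* Adding 1 keeps the factor positive when [C = 0]. *)
exists (C + 1)^-1; first by rewrite invr_gt0; lra.
apply: psd_tensP => [|l].
  apply/symmetric_tensP => k l; rewrite !add_lfunE !scale_lfunE !linearD /=.
  by rewrite !linearZ /= uE ((symmetric_tensP t).1 st).
rewrite add_lfunE scale_lfunE linearD linearZ /=.
have pt : psd_tens t by exists r, p.
have := bound l; have := psd_ge0 l pt.
move: (l (t l) : R) (l (u l) : R) => a b a0 bb.
have : - (C + 1)^-1 * `|b| <= (C + 1)^-1 * b.
  by rewrite mulNr -mulrN ler_wpM2l ?invr_ge0; [|lra|rewrite lerNl -normrN ler_norm].
have : (C + 1)^-1 * `|b| <= a.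
  rewrite ler_pdivrMl; last by rewrite ltr_wpDl.
  by apply: le_trans bb _; rewrite mulrDl mul1r lerDl.
by rewrite /GRing.scale /= => h1 h2; move: h1 h2; rewrite mulNr; lra.
Qed.

End PsdTensors.

(** * Dimension of the space of symmetric tensors *)

Section SymmetricTensors.
Local Open Scope ring_scope.
Variables (K : fieldType) (V : vectType K).
Implicit Types (k l : 'Hom(V, K^o)) (t : tens2 V).

Let n := \dim {:V}.
Let b (i : 'I_n) : V := (vbasis {:V})`_i.

Definition ordered_pair := {p : 'I_n * 'I_n | (p.1 <= p.2)%N}.

Fact unordered_subproof (i j : 'I_n) :
  let p := if (i <= j)%N then (i, j) else (j, i) in (p.1 <= p.2)%N.
Proof. by case: leqP => // /ltnW. Qed.

Definition unordered (i j : 'I_n) : ordered_pair :=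
  exist (fun p : 'I_n * 'I_n => (p.1 <= p.2)%N) _ (unordered_subproof i j).

(** Indexing coefficients by pairs [i <= j] parametrises each symmetric tensor exactly once, so the
    dimension becomes a count of pairs. *)
Definition sym_of (s : {ffun ordered_pair -> K^o}) : tens2 V :=
  \sum_(i < n) \sum_(j < n) (s (unordered i j) : K) *: tens (b i) (b j).

Fact sym_of_linear : linear sym_of.
Proof.
move=> a s s'; rewrite /sym_of scaler_sumr -big_split; apply: eq_bigr => i _ /=.
rewrite scaler_sumr -big_split; apply: eq_bigr => j _ /=.
by rewrite !ffunE scalerDl scalerA.
Qed.
HB.instance Definition _ := GRing.isLinear.Build _ _ _ _ sym_of sym_of_linear.

Definition sym_space : {vspace tens2 V} := limg (linfun sym_of).

Lemma unorderedC i j : unordered i j = unordered j i.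
Proof.
apply: val_inj => /=; case: ltngtP => // ij.
by have -> : i = j by apply: val_inj.
Qed.

Lemma dual_basis_vbasis (i j : 'I_n) : dual_basis i (b j) = (i == j)%:R :> K.
Proof.
by rewrite dual_basisE (coord_free _ _ (basis_free (vbasisP _))) eq_sym.
Qed.

Lemma sym_ofE s (i j : 'I_n) :
  dual_basis j (sym_of s (dual_basis i)) = (s (unordered i j) : K).
Proof.
rewrite /sym_of sum_lfunE linear_sum (bigD1 i) //= [X in _ + X]big1 => [|k ki].
  rewrite addr0 sum_lfunE linear_sum (bigD1 j) //= big1 => [|k kj].
    rewrite scale_lfunE tensE !linearZ /= !dual_basis_vbasis !eqxx.
    by rewrite /GRing.scale /= !mulr1 addr0.
  rewrite scale_lfunE tensE !linearZ /= !dual_basis_vbasis eq_sym (negbTE kj).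
  by rewrite !scaler0.
rewrite sum_lfunE linear_sum big1// => j' _.
rewrite scale_lfunE tensE !linearZ /= !dual_basis_vbasis eq_sym (negbTE ki).
by rewrite scale0r scaler0.
Qed.

Lemma mem_sym_space t : t \in sym_space <-> symmetric_tens t.
Proof.
split=> [/memv_imgP[s _ ->]|/symmetric_tensP st].
  rewrite lfunE /=; apply/symmetric_tensP.
  have E k l : k (sym_of s l) = \sum_(i < n) \sum_(j < n)
      (s (unordered i j) : K) * ((l (b i) : K) * (k (b j) : K)).
    rewrite /sym_of sum_lfunE linear_sum; apply: eq_bigr => i _.
    rewrite sum_lfunE linear_sum; apply: eq_bigr => j _.
    by rewrite scale_lfunE tensE !linearZ.
  move=> k l; rewrite !E exchange_big; apply: eq_bigr => i _; apply: eq_bigr => j _.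
  by rewrite unorderedC [X in _ * X]mulrC.
pose s : {ffun ordered_pair -> K^o} :=
  [ffun p => dual_basis (val p).1 (t (dual_basis (val p).2))].
have -> : t = linfun sym_of s; last by rewrite memv_img ?memvf.
rewrite lfunE /= /sym_of {1}(tens_sum t); apply: eq_bigr => i _.
rewrite -{1}(sum_dual_basis (t (dual_basis i))).
have := tens_linearr (vbasis {:V})`_i.
move=> lin; pose gl := GRing.isLinear.Build _ _ _ _ _ lin.
pose Fl : {linear V -> tens2 V} := HB.pack (tens (vbasis {:V})`_i) gl.
transitivity (Fl (\sum_(j < n) (dual_basis j (t (dual_basis i)) : K) *: b j)) => //.
rewrite linear_sum; apply: eq_bigr => j _; rewrite linearZ /=.
congr (_ *: _); rewrite ffunE /=; case: ifP => //= _; exact: st.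
Qed.

Lemma card_ordered_pair : #|{: ordered_pair}| = 'C(n.+1, 2).
Proof.
rewrite card_sig -sum1_card.
rewrite -(pair_big_dep xpredT (fun i j : 'I_n => (i <= j)%N) (fun _ _ => 1%N)) /=.
rewrite (exchange_big_dep xpredT) //= -bin2_sum big_mkord big_ord_recl /= add0n.
apply: eq_bigr => j _; rewrite /bump /= add1n.
by rewrite -(big_ord_widen n (fun=> 1%N) (ltn_ord j)) sum1_card card_ord.
Qed.

Lemma dim_sym_space : \dim sym_space = 'C(n.+1, 2).
Proof.
rewrite /sym_space limg_dim_eq; first (rewrite dimvf -card_ordered_pair; exact: muln1).
apply/eqP; rewrite -subv0; apply/subvP => s; rewrite memv_cap => /andP[_].
rewrite memv_ker lfunE /= => /eqP s0; rewrite memv0; apply/eqP/ffunP => -[[i j] /= ij].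
have := sym_ofE s i j; rewrite s0 zero_lfunE linear0 ffunE => ->.
by congr (s _); apply: val_inj; rewrite /= ij.
Qed.

End SymmetricTensors.

(** * Symmetric tensors in the kernel of a linear map *)

Section SymmetricKernel.
Local Open Scope ring_scope.
Variables (K : fieldType) (V W : vectType K) (mu : {linear tens2 V -> W}).
Implicit Types (l : 'Hom(V, K^o)) (t : tens2 V) (p q : V).

Definition tens_at l t : V := t l.

Fact tens_at_linear l : linear (tens_at l).
Proof. by move=> a t t'; rewrite /tens_at add_lfunE scale_lfunE. Qed.
HB.instance Definition _ l :=
  GRing.isLinear.Build _ _ _ _ (tens_at l) (@tens_at_linear l).

Definition sym_kernel : {vspace tens2 V} := (sym_space V :&: lker (linfun mu))%VS.

Definition sym_kernel_at l : {vspace tens2 V} :=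
  (sym_space V :&: (lker (linfun mu) :&: lker (linfun (tens_at l))))%VS.

Lemma mem_sym_kernel t : t \in sym_kernel <-> symmetric_tens t /\ mu t = 0.
Proof.
rewrite memv_cap memv_lker_linfun; split=> [/andP[/mem_sym_space st /eqP]|] //.
by move=> [/mem_sym_space-> ->] /=.
Qed.

Lemma mem_sym_kernel_at l t : symmetric_tens t -> mu t = 0 -> t l = 0 ->
  t \in sym_kernel_at l.
Proof.
move=> /mem_sym_space st mt tl.
by rewrite !memv_cap st !memv_lker_linfun mt /= /tens_at tl !eqxx.
Qed.

Lemma dim_sym_kernel : ('C((\dim {:V}).+1, 2) <= \dim sym_kernel + \dim {:W})%N.
Proof.
rewrite -dim_sym_space -(limg_ker_dim (linfun mu)) leq_add2l.
by apply: dimvS; exact: subvf.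
Qed.

(** A pair annihilating the image of [t |-> (mu t, t l)] is tested on [tens p q + tens q p]; the
    condition at [w] uses up one dimension of the annihilator. *)
Lemma sym_kernel_at_annihilator l (w : V) (n : nat) :
  ('C((\dim {:V}).+1, 2) <= \dim (sym_kernel_at l) + n)%N ->
  (n + 1 < \dim {:W} + \dim {:V})%N ->
  exists (k : 'Hom(W, K^o)) (m : 'Hom(V, K^o)),
    [/\ forall p q, k (mu (tens p q)) + k (mu (tens q p)) +
          ((l p : K) * m q + m p * l q) = 0 :> K,
        m w = 0 & ~ (k = 0 /\ m = 0)].
Proof.
rewrite -dim_sym_space => dS dn.
have [k [m [km mw nz]]] := @joint_kernel_annihilator _ _ _ _
  mu (tens_at l) (sym_space V) w n dS dn.
exists k, m; split=> // p q.
have tS : tens p q + tens q p \in sym_space V.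
  apply/mem_sym_space/symmetric_tensP => k' l'; rewrite !add_lfunE !tensE !linearD !linearZ /=.
  by rewrite /GRing.scale /= addrC [X in _ + X]mulrC [X in X + _]mulrC.
have := km _ tS; rewrite /= /tens_at add_lfunE !tensE !linearD !linearZ /= => <-.
by congr (_ + (_ + _)); rewrite mulrC.
Qed.

Lemma symmetric_tensD t t' : symmetric_tens t -> symmetric_tens t' -> symmetric_tens (t + t').
Proof. by move=> /mem_sym_space st /mem_sym_space st'; apply/mem_sym_space/memvD. Qed.

Lemma symmetric_tensZ a t : symmetric_tens t -> symmetric_tens (a *: t).
Proof. by move=> /mem_sym_space st; apply/mem_sym_space/memvZ. Qed.

Lemma symmetric_tensB t t' : symmetric_tens t -> symmetric_tens t' -> symmetric_tens (t - t').
Proof. by move=> /mem_sym_space st /mem_sym_space st'; apply/mem_sym_space/memvB. Qed.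

End SymmetricKernel.

(** * Hankel matrices that are symmetrised products *)

Section HankelSequences.
Local Open Scope ring_scope.
Variables (R : realFieldType) (d : nat).
Hypothesis d_ge3 : (3 <= d)%N.
Implicit Types lam h m : nat -> R.

(* The values on the monomials of a multiple of evaluation at a point [(1 : a)]
   or, in the second case, at [(0 : 1)]. *)
Definition evaluation_seq lam :=
  (exists c a, forall i, (i <= d)%N -> lam i = c * a ^+ i) \/
  (forall i, (i < d)%N -> lam i = 0).

Definition hankel_product lam h m :=
  forall i j, (i <= d)%N -> (j <= d)%N -> h (i + j)%N = lam i * m j + m i * lam j.

(** The positions [(i + 1, j)] and [(i, j + 1)] lie on one antidiagonal, which eliminates [h]. *)
Lemma hankel_shift lam h m i j : hankel_product lam h m ->
  (i.+1 <= d)%N -> (j.+1 <= d)%N ->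
  lam i.+1 * m j + m i.+1 * lam j = lam i * m j.+1 + m i * lam j.+1.
Proof.
move=> H hi hj; rewrite -!H ?addSnnS//; exact: ltnW.
Qed.

(** Naming the difference lets later identities be explicit combinations checked by [ring]. *)
Lemma eq_sub0 (x y : R) : x = y -> exists2 z, z = x - y & z = 0.
Proof. by move=> ->; exists 0; rewrite ?subrr. Qed.

(** At [i = 0] the shift relation is a recursion for [m (j + 1)], as [lam 0] is invertible. *)
Lemma hankel_product_eq0 lam h m : hankel_product lam h m ->
  lam 0%N != 0 -> m 0%N = 0 -> m 1%N = 0 -> forall j, (j <= d)%N -> m j = 0.
Proof.
move=> H l0 m0 m1; elim=> // j IH jd.
have := hankel_shift H (ltnW (ltnW d_ge3)) jd.
rewrite m0 m1 (IH (ltnW jd)) !mul0r mulr0 !addr0 => /esym/eqP.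
by rewrite mulf_eq0 (negbTE l0) => /eqP.
Qed.

Lemma hankel_geometric lam h m h' m' : lam 0%N != 0 ->
  hankel_product lam h m -> m 0%N = 0 -> m 1%N != 0 ->
  hankel_product lam h' m' -> m' 0%N != 0 -> m' 1%N = 0 ->
  forall i, (i <= d)%N -> lam i = lam 0%N * (lam 1%N / lam 0%N) ^+ i.
Proof.
move=> l0 H m0 m1 H' m'0 m'1.
have d1 : (1 <= d)%N by apply: ltnW; apply: ltnW.
have d2 : (2 <= d)%N by apply: ltnW.
set a0 := lam 0%N in l0 *; set a1 := lam 1%N; set a2 := lam 2%N; set a3 := lam 3%N.
have [x1 x1E x10] := eq_sub0 (hankel_shift H' d1 d2).
have [x2 x2E x20] := eq_sub0 (hankel_shift H' d1 d_ge3).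
have [x3 x3E x30] := eq_sub0 (hankel_shift H' d2 d_ge3).
have [y1 y1E y10] := eq_sub0 (hankel_shift H d1 d2).
have [y2 y2E y20] := eq_sub0 (hankel_shift H d1 d_ge3).
have [y3 y3E y30] := eq_sub0 (hankel_shift H d2 d_ge3).
rewrite m'1 -/a0 -/a1 -/a2 -/a3 in x1E x2E x3E.
rewrite m0 -/a0 -/a1 -/a2 -/a3 in y1E y2E y3E.
(* [A] and [B] come from eliminating entries 2 and 3 of [m'] and of [m] from the three shift
   relations with indices up to 3. *)
have A : a0 *+ 2 * a2 ^+ 2 - a1 ^+ 2 * a2 - a0 * a1 * a3 = 0.
  apply: (mulfI m'0); rewrite mulr0.
  transitivity (- a0 ^+ 2 * x3 + a0 * a1 * x2 - (a0 *+ 2 * a2 - a1 ^+ 2) * x1).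
    by rewrite x1E x2E x3E; ring.
  by rewrite x10 x20 x30; ring.
have B : a0 * a1 * a2 *+ 3 - a1 ^+ 3 *+ 2 - a0 ^+ 2 * a3 = 0.
  apply: (mulfI m1); rewrite mulr0.
  transitivity (a0 ^+ 2 * y3 - a0 * a1 * y2 + (a0 *+ 2 * a2 - a1 ^+ 2) * y1).
    by rewrite y1E y2E y3E; ring.
  by rewrite y10 y20 y30; ring.
(* Eliminating [a3] from [A] and [B] leaves the square of [a0 a2 - a1^2]. *)
have C : a0 * a2 = a1 ^+ 2.
  apply/eqP; rewrite -subr_eq0 -sqrf_eq0.
  move: A B; set A := (X in X = 0 -> _); set B := (X in _ -> X = 0 -> _) => A0 B0.
  have -> : (a0 * a2 - a1 ^+ 2) ^+ 2 = (a0 * A - a1 * B) / 2 by rewrite /A /B; field.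
  by rewrite A0 B0 !mulr0 subrr mul0r.
have m2 : a0 * m 2%N = a1 * m 1%N *+ 2.
  by apply/eqP; rewrite -subr_eq0 -oppr_eq0 -[X in _ == X]y10 y1E; apply/eqP; ring.
have step j : (j.+1 <= d)%N -> a0 * lam j.+1 = a1 * lam j.
  move=> jd; have [z1 z1E z10] := eq_sub0 (hankel_shift H d1 jd).
  have [z2 z2E z20] := eq_sub0 (hankel_shift H d2 jd).
  rewrite m0 -/a0 -/a1 -/a2 in z1E z2E.
  apply: (mulfI m1); apply/eqP; rewrite -subr_eq0; apply/eqP.
  (* The relations at [(0, j)] and [(1, j)] are combined so that [m (j + 1)] cancels. *)
  transitivity (a1 * z1 - a0 * z2 + (a0 * m 2%N - a1 * m 1%N *+ 2) * lam j
    + (a0 * a2 - a1 ^+ 2) * m j); first by rewrite z1E z2E; ring.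
  by rewrite m2 C z10 z20; ring.
elim=> [|j IH] jd; first by rewrite mulr1.
apply: (mulfI l0); rewrite step// IH ?(ltnW jd)// exprS.
by move: ((_ / _) ^+ j) => x; field.
Qed.

(* The remaining case [lam 0 = 0]: here [k] is the first index with
   [lam k != 0]. *)
Lemma hankel_degenerate lam h m k : hankel_product lam h m ->
  (forall i, (i < k)%N -> lam i = 0) -> lam k != 0 -> (0 < k < d)%N -> m 0%N = 0 ->
  forall j, (j < d)%N -> m j = 0.
Proof.
move=> H lk k0 /andP[kgt0 kd] m0; elim/ltn_ind=> -[//|j] IH jd.
(* In each case a shift relation reduces to [lam k * m (j + 1) = 0], with a factor 2 when
   [j + 1 = k]. *)
case: (ltngtP j.+1 k) => jk.
- have := hankel_shift H kd (ltnW jd).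
  rewrite (IH j (leqnn _) (ltnW jd)) (lk j (ltnW jk)) (lk j.+1 jk) !mulr0 !addr0.
  by move=> /esym/eqP; rewrite mulf_eq0 (negbTE k0) => /eqP.
- have kE : k = k.-1.+1 by rewrite prednK.
  have := @hankel_shift _ _ _ k.-1 j.+1 H; rewrite -kE => /(_ (ltnW kd) jd).
  have k1 : (k.-1 < k)%N by rewrite [X in (_ < X)%N]kE.
  rewrite (lk k.-1 k1) (IH k jk kd) (IH k.-1 (ltn_trans k1 jk) (ltn_trans k1 kd)).
  rewrite !mul0r !addr0 => /eqP; by rewrite mulf_eq0 (negbTE k0) => /eqP.
- have := hankel_shift H kd (ltnW jd).
  rewrite (IH j (leqnn _) (ltnW jd)) (lk j) -?jk// !mulr0 !addr0 jk.
  rewrite mulrC -mulr2n => /esym/eqP.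
  by rewrite mulrn_eq0 /= mulf_eq0 (negbTE k0) orbF => /eqP.
Qed.

(** The hypothesis encodes a plane of solutions, which contains a nonzero [m] vanishing at any given
    index. Only the indices 0, 1 and [d] are used. *)
Lemma hankel_evaluation lam :
  (forall k, (k <= d)%N -> exists h m, [/\ hankel_product lam h m, m k = 0 &
     exists2 j, (j <= d)%N & m j != 0]) ->
  evaluation_seq lam.
Proof.
move=> ex; have d1 : (1 <= d)%N by apply: ltnW; apply: ltnW.
have [l0|l0] := eqVneq (lam 0%N) 0; last first.
  have [h [m [H m0 [j jd mj]]]] := ex 0%N isT.
  have [h' [m' [H' m'1 [j' jd' mj']]]] := ex 1%N d1.
  left; exists (lam 0%N), (lam 1%N / lam 0%N).
  apply: (hankel_geometric l0 H m0 _ H' _ m'1).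
    by apply: contra_neq mj => m1; apply: (hankel_product_eq0 H).
  by apply: contra_neq mj' => m'0; apply: (hankel_product_eq0 H').
right=> i id; apply/eqP; apply: contraT => li.
have exk : exists k, lam k != 0 by exists i.
case: (ex_minnP exk) => k lk kmin.
have lt0 i' : (i' < k)%N -> lam i' = 0.
  by move=> ik; apply/eqP; apply: contraT => /kmin; rewrite leqNgt ik.
have kd : (k < d)%N by apply: leq_ltn_trans id; apply: kmin.
have k0 : (0 < k)%N by rewrite lt0n; apply: contra_neq lk => ->.
(* For [k = 1], the solution with [m 0 = 0] is shown to have [m d = 0]; for [k > 1], the one with
   [m d = 0] is shown to have [m 0 = 0]. *)
have [k1|k1] := eqVneq k 1%N.
  have [h [m [H m0 [j jd]]]] := ex 0%N isT.
  have mlt := hankel_degenerate H lt0 lk (introT andP (conj k0 kd)) m0.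
  suff md : m d = 0.
    by move: jd; rewrite leq_eqVlt => /orP[/eqP->|/mlt->]; rewrite ?md eqxx.
  subst k; have dE : d = d.-1.+1 by rewrite prednK.
  have := @hankel_shift _ _ _ 1 d.-1 H kd; rewrite -dE => /(_ (leqnn _)).
  rewrite (mlt 2%N)// (mlt 1%N)// (mlt d.-1) -?dE// mulr0 !mul0r !addr0.
  by move=> /esym/eqP; rewrite mulf_eq0 (negbTE lk) => /eqP.
have [h [m [H md [j jd]]]] := ex d (leqnn d).
suff m0 : m 0%N = 0.
  have mlt := hankel_degenerate H lt0 lk (introT andP (conj k0 kd)) m0.
  by move: jd; rewrite leq_eqVlt => /orP[/eqP->|/mlt->]; rewrite ?md eqxx.
have k2 : (1 < k)%N by rewrite ltn_neqAle eq_sym k1.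
have kE : k = k.-1.+1 by rewrite prednK.
have := @hankel_shift _ _ _ 0 k.-1 H d1; rewrite -kE => /(_ (ltnW kd)).
rewrite (lt0 1%N)// (lt0 k.-1) -?kE// l0 mulr0 !mul0r !add0r.
by move=> /esym/eqP; rewrite mulf_eq0 (negbTE lk) orbF => /eqP.
Qed.

(** Evaluations satisfy [l 0 * l 2 = l 1 ^ 2]; for a sum of two at finite points this gives
    [c c' (a - a')^2 = 0]. Evaluation at [(0 : 1)] affects only the last entry, which a nonzero
    finite evaluation already determines from the first two. *)
Lemma evaluation_seq_pencil lam lam' : evaluation_seq lam -> evaluation_seq lam' ->
  evaluation_seq (fun i => lam i + lam' i) ->
  (forall i, (i <= d)%N -> lam i = 0) \/
  (exists s, forall i, (i <= d)%N -> lam' i = s * lam i).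
Proof.
have d2 : (1 < d)%N by apply: ltnW.
have d1 : (0 < d)%N by apply: ltnW.
have quad l : evaluation_seq l -> l 0%N * l 2%N = l 1%N ^+ 2.
  by move=> [[c [a E]]|E]; rewrite !E//; ring.
have at_d l : evaluation_seq l -> l 0%N != 0 -> l d = l 0%N * (l 1%N / l 0%N) ^+ d.
  move=> [[c [a E]]|E]; last by rewrite E ?eqxx.
  by rewrite !E// expr0 expr1 mulr1 => c0; rewrite [c * a]mulrC mulfK.
move=> El El' Es; have q := quad _ Es; have dd := at_d _ Es; move: q dd.
case: El El' => [[c [a E]]|E] [[c' [a' E']]|E'] q dd.
- have [c0|c0] := eqVneq c 0; first by left=> i /E->; rewrite c0 mul0r.
  right; exists (c' / c) => i id; rewrite E// E'//.
  have [->|c'0] := eqVneq c' 0; first by rewrite !mul0r.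
  suff -> : a' = a by move: (a ^+ i) => x; field.
  move: q; rewrite !E ?E'// => /eq_sub0[z zE z0].
  apply/eqP; rewrite -subr_eq0 -sqrf_eq0; apply/eqP.
  by apply: (mulfI c0); apply: (mulfI c'0); rewrite !mulr0 -z0 zE; ring.
- have [c0|c0] := eqVneq c 0; first by left=> i /E->; rewrite c0 mul0r.
  right; exists 0 => i; rewrite mul0r leq_eqVlt => /orP[/eqP->|/E'//].
  move: dd; rewrite !E// (E' 0%N d1) (E' 1%N d2) expr0 expr1 mulr1 !addr0 => /(_ c0).
  by rewrite [c * a]mulrC mulfK// => /eqP; rewrite addrC -subr_eq0 addrK => /eqP.
- have [c0|c0] := eqVneq c' 0; first by right; exists 0 => i /E'->; rewrite c0 !mul0r.
  left=> i; rewrite leq_eqVlt => /orP[/eqP->|/E//].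
  move: dd; rewrite !E'// (E 0%N d1) (E 1%N d2) expr0 expr1 mulr1 !add0r => /(_ c0).
  by rewrite [c' * a']mulrC mulfK// => /eqP; rewrite -subr_eq0 addrK => /eqP.
- have [l0|l0] := eqVneq (lam d) 0.
    by left=> i; rewrite leq_eqVlt => /orP[/eqP->|/E].
  right; exists (lam' d / lam d) => i; rewrite leq_eqVlt => /orP[/eqP->|id].
    by rewrite divfK.
  by rewrite (E i id) (E' i id) mulr0.
Qed.

End HankelSequences.

(** * Monomials, evaluations and multiplication of binary forms *)

Section Forms.
Local Open Scope ring_scope.
Variable R : realType.

Definition mono_exp (m i : nat) : 'X_{1..2} :=
  ([multinom if j == ord0 then (m - i)%N else i | j < 2])%MM.

Lemma mono_homog m i : (i <= m)%N -> ('X_[mono_exp m i] : {mpoly R[2]}) \is m.-homog.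
Proof.
by move=> im; rewrite dhomogX /= mdegE 2!big_ord_recl big_ord0 !mnmE /= addn0 subnK.
Qed.

(** For [i > m] the truncated subtraction gives a wrong degree and [indhomog] returns its default,
    hence the bounds [i <= m] below. *)
Definition mono m i : binary_form R m := indhomog m 'X_[mono_exp m i].

Lemma val_mono m i : (i <= m)%N ->
  mpoly_of_dhomog (mono m i) = 'X_[mono_exp m i].
Proof. by move=> im; rewrite /mono /indhomog val_insubd mono_homog. Qed.

Lemma mono_expand m (p : binary_form R m) :
  p = \sum_(e <- msupp (mpoly_of_dhomog p)) (mpoly_of_dhomog p)@_e *: mono m (e (lift ord0 ord0)).
Proof.
apply: val_inj; rewrite linear_sum /= {1}[mpoly_of_dhomog p]mpolyE.
rewrite big_seq [RHS]big_seq; apply: eq_bigr => e ep.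
have /dhomogP/(_ _ ep) : mpoly_of_dhomog p \is m.-homog by exact: dhomog_is_dhomog.
rewrite /= mdegE 2!big_ord_recl big_ord0 addn0 => em.
rewrite val_mono -?em ?leq_addl//; congr (_ *: 'X_[_]).
apply/mnmP => j; rewrite mnmE; case: eqP => [->|/eqP j0]; first by rewrite -em addnK.
by congr (e _); apply: val_inj; case: j j0 => -[|[|j]].
Qed.

Lemma mono_eq_linear m (W : lmodType R) (f g : {linear binary_form R m -> W}) :
  (forall i, (i <= m)%N -> f (mono m i) = g (mono m i)) -> f =1 g.
Proof.
move=> fg p; rewrite (mono_expand p) !linear_sum big_seq [RHS]big_seq.
apply: eq_bigr => e ep; rewrite !linearZ /= fg//.
have /dhomogP/(_ _ ep) : mpoly_of_dhomog p \is m.-homog by exact: dhomog_is_dhomog.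
by rewrite /= mdegE 2!big_ord_recl big_ord0 addn0 => <-; rewrite leq_addl.
Qed.

Lemma form_mul_mono d i j : (i <= d)%N -> (j <= d)%N ->
  form_mul (mono d i) (mono d j) = mono (2 * d) (i + j).
Proof.
move=> id jd; apply: val_inj; rewrite /= !val_mono//; last by rewrite mul2n -addnn leq_add.
rewrite -mpolyXD; congr 'X_[_]; apply/mnmP => k; rewrite mnmDE !mnmE.
by case: ifP => // _; lia.
Qed.

Definition feval_at m a b (p : binary_form R m) : R^o := feval p a b.

Fact feval_at_linear m a b : linear (@feval_at m a b).
Proof. by move=> c p q; rewrite /feval_at /feval /= mevalD mevalZ. Qed.
HB.instance Definition _ m a b := GRing.isLinear.Build _ _ _ _
  (@feval_at m a b) (@feval_at_linear m a b).

Definition ev m a b : 'Hom(binary_form R m, R^o) := linfun (@feval_at m a b).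

Lemma evE m a b p : ev m a b p = feval p a b.
Proof. by rewrite lfunE. Qed.

Lemma feval_mono m i a b : (i <= m)%N -> feval (mono m i) a b = a ^+ (m - i) * b ^+ i.
Proof.
move=> im; rewrite /feval val_mono// mevalX 2!big_ord_recl big_ord0 mulr1.
by rewrite !mnmE.
Qed.

Lemma feval_form_mul d (p q : binary_form R d) a b :
  feval (form_mul p q) a b = feval p a b * feval q a b.
Proof. by rewrite /feval /= mevalM. Qed.

Lemma dim_forms m : \dim {: binary_form R m} = m.+1.
Proof. by rewrite dimvf /dim /= addn1 binSn. Qed.

Fact mu_linear d : linear (@mu R d).
Proof.
apply: tens_lift_linear => u a v w; apply: val_inj => /=.
by rewrite mulrDr scalerAr.
Qed.
HB.instance Definition _ d := GRing.isLinear.Build _ _ _ _ (@mu R d) (@mu_linear d).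

(* Named so that the canonical structures on forms are not inferred again, at
   great cost, in every statement about the kernel of [mu]. *)
Definition lin_mu d : {linear tens2 (binary_form R d) -> binary_form R (2 * d)} :=
  @mu R d.

Section Kernel.
Variable d : nat.
Local Notation V := (binary_form R d).

Lemma evaluation_seqP (l : 'Hom(V, R^o)) : evaluation_seq d (fun i => l (mono d i) : R) ->
  exists c a b, (a, b) != (0, 0) /\ forall p, l p = c * feval p a b.
Proof.
have E c a b (e : forall i, (i <= d)%N -> l (mono d i) = c * feval (mono d i) a b) p :
    l p = c * feval p a b.
  rewrite -evE; have -> : c * ev d a b p = (c *: ev d a b) p by rewrite scale_lfunE.
  apply: mono_eq_linear => i id; by rewrite /= scale_lfunE evE e.
move=> [[c [a El]]|El].
  exists c, 1, a; split; first by rewrite xpair_eqE oner_eq0.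
  by apply: E => i id; rewrite El// feval_mono// expr1n mul1r.
exists (l (mono d d)), 0, 1; split; first by rewrite xpair_eqE oner_eq0 andbF.
apply: E => i; rewrite leq_eqVlt => /orP[/eqP->|id].
  by rewrite feval_mono// subnn expr0 expr1n !mulr1.
rewrite El// feval_mono; last exact: ltnW.
by rewrite expr0n subn_eq0 leqNgt id mul0r mulr0.
Qed.

(** The left side is the dimension of the symmetric tensors, so [3 * d] bounds the rank of
    [t |-> (mu t, t l)] when its kernel has dimension at least ['C(d - 1, 2)]. *)
Lemma bin2_gap : (0 < d)%N -> 'C(d.+2, 2) = ('C(d - 1, 2) + 3 * d)%N.
Proof. by case: d => // e _; rewrite subn1 /= !binS !bin1 !bin0; lia. Qed.

Definition gram_directions (l : 'Hom(V, R^o)) : {vspace tens2 V} :=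
  @sym_kernel_at R V (binary_form R (2 * d)) (lin_mu d) l.

(** The rank is at most [3 * d] in a space of dimension [3 * d + 2]; taking [w = mono d k] gives the
    solution vanishing at [k]. *)
Lemma large_directions_evaluation (l : 'Hom(V, R^o)) : (3 <= d)%N ->
  ('C(d - 1, 2) <= \dim (gram_directions l))%N ->
  evaluation_seq d (fun i => l (mono d i) : R).
Proof.
move=> d3 dimK; apply: hankel_evaluation => // k kd.
have [||L1 [L2 [LS Lw Lneq]]] := @sym_kernel_at_annihilator R V (binary_form R (2 * d))
  (lin_mu d) l (mono d k) (3 * d).
- by rewrite dim_forms bin2_gap ?leq_add2r//; apply: leq_trans d3.
- by rewrite !dim_forms; lia.
(* [h] is scaled by [-2] because [tens p q + tens q p] is sent to [2 p q]. *)
pose h i : R := - 2 * (L1 (mono (2 * d) i) : R).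
pose m i : R := L2 (mono d i).
have hm : hankel_product d (fun i => l (mono d i) : R) h m.
  move=> i j id jd; have := LS (mono d i) (mono d j).
  rewrite /lin_mu /= !mu_tens !form_mul_mono// [(j + i)%N]addnC => e.
  apply/eqP; rewrite -subr_eq0 -oppr_eq0 -[X in _ == X]e /h /m.
  by apply/eqP; ring.
exists h, m; split=> //.
(* If [m] vanished, so would [h], since every index up to [2 * d] is a sum of two indices up to
   [d]. *)
apply: contrapT => nm; apply: Lneq.
have m0 j : (j <= d)%N -> m j = 0.
  by move=> jd; apply/eqP; apply: contraT => mj; exfalso; apply: nm; exists j.
have h0 i : (i <= 2 * d)%N -> h i = 0.
  move=> i2; have := hm (minn i d) (i - minn i d)%N (geq_minr _ _).
  rewrite subnKC ?geq_minl// => ->; last by lia.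
  by rewrite !m0 ?geq_minr ?mulr0 ?mul0r ?addr0//; lia.
split; apply/lfunP; apply: mono_eq_linear => i id; rewrite /= zero_lfunE; last exact: m0.
by apply/eqP; have /eqP := h0 i id; rewrite mulf_eq0 oppr_eq0 pnatr_eq0.
Qed.

End Kernel.
End Forms.

(** * Bounds on the affine dimension *)

Section Spans.
Local Open Scope classical_set_scope.
Local Open Scope ring_scope.
Variables (K : fieldType) (V : vectType K).
Implicit Types (A : set V) (W : {vspace V}).

Lemma affdim_le A W : (forall x y, A x -> A y -> x - y \in W) -> (affdim A <= \dim W)%N.
Proof.
move=> AW; apply: dimvS; apply: (span_setP _).2 => _ /= [x [y [Ax Ay ->]]].
exact: AW.
Qed.

(** The factor [e] accommodates psd perturbations, which are available only for some positive
    multiple of a direction. *)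
Lemma affdim_ge A W :
  (forall w, w \in W -> exists2 e : K, e != 0 &
     exists x y, [/\ A x, A y & e *: w = x - y]) ->
  (\dim W <= affdim A)%N.
Proof.
move=> WA; apply: dimvS; apply/subvP => w /WA[e e0 [x [y [Ax Ay ew]]]].
rewrite -[w](scalerK e0) memvZ// ew.
by apply: (span_setP _).1 => /=; exists x, y.
Qed.

End Spans.

(** * Faces of Gram spectrahedra *)

Section Faces.
Local Open Scope classical_set_scope.
Local Open Scope ring_scope.
Variables (R : realType) (d : nat).
Local Notation V := (binary_form R d).
Implicit Types (f : binary_form R (2 * d)) (F : set (tens2 V)) (t : tens2 V).

Lemma limg_face_space F t : F t -> (limg t <= face_space F)%VS.
Proof.
move=> Ft; apply/subvP => v vt; apply: (span_setP _).1.
by exists t.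
Qed.

Lemma face_space_le F (W : {vspace V}) :
  (forall t, F t -> (limg t <= W)%VS) -> (face_space F <= W)%VS.
Proof.
move=> FW; apply: (span_setP _).2 => v [t Ft /= vt].
exact: (subvP (FW t Ft)).
Qed.

Lemma midpoint_face f F t t' : face (Gram f) F -> F t -> F t' ->
  F (2^-1 *: t + (1 - 2^-1) *: t').
Proof.
move=> [_ cF _] Ft Ft'.
have h0 : 0 <= 2^-1 :> R by rewrite invr_ge0.
have h1 : 2^-1 <= 1 :> R by rewrite invf_le1// ler1n.
exact: set_mem (cF t t' (Itv01 h0 h1) (mem_set Ft) (mem_set Ft')).
Qed.

(** The image at the midpoint of [t0] and [t] contains both images; if [t0] has maximal rank, it
    equals that of [t0]. *)
Lemma face_max_rank f F t1 : face (Gram f) F -> F t1 ->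
  exists2 t0, F t0 & limg t0 = face_space F.
Proof.
move=> fF Ft1; have [FG _ _] := fF.
pose P n := `[< exists2 t, F t & \dim (limg t) = n >].
have exP : exists n, P n by exists (\dim (limg t1)); apply/asboolP; exists t1.
have ubP n : P n -> (n <= \dim {:V})%N.
  by move=> /asboolP[t _ <-]; apply: dimvS; exact: subvf.
case: (ex_maxnP exP ubP) => n /asboolP[t0 Ft0 dt0] nmax.
exists t0 => //; apply/eqP; rewrite eqEsubv limg_face_space//=.
apply: face_space_le => t Ft.
have [st pt _] := FG _ Ft; have [st0 pt0 _] := FG _ Ft0.
have Fm := midpoint_face fF Ft0 Ft; have [_ pm _] := FG _ Fm.
have h0 : 0 < 2^-1 :> R by rewrite invr_gt0.
have h1 : 0 < 1 - 2^-1 :> R by rewrite subr_gt0 invf_lt1// ltr1n.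
have [s0 s1] := limg_psd_comb h0 h1 pt0 pt pm.
set m := (X in F X) in Fm s0 s1.
have /eqP-> : limg t0 == limg m.
  by rewrite eqEdim s0 dt0 nmax//; apply/asboolP; exists m.
exact: s1.
Qed.

Lemma full_face f F t0 : face (Gram f) F -> F t0 ->
  (forall t, Gram f t -> (limg t <= limg t0)%VS) -> F = Gram f.
Proof.
move=> [FG _ eF] Ft0 sub; apply/seteqP; split=> // t Gt.
have [st0 pt0 mt0] := FG _ Ft0; have [st pt mt] := Gt.
have su : symmetric_tens (t0 - t) by exact: symmetric_tensB.
have lu : (limg (t0 - t)%R <= limg t0)%VS.
  apply/subvP => _ /memv_imgP[l _ ->]; rewrite add_lfunE opp_lfunE memvB//.
    by rewrite memv_img ?memvf.
  by apply: (subvP (sub _ Gt)); rewrite memv_img ?memvf.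
(* [t0] lies strictly between [t] and [t0 + e (t0 - t)], both in [Gram f]. *)
have [e e0 pe] := psd_perturb pt0 st0 su lu.
have Ge : Gram f (t0 + e *: (t0 - t)).
  split=> //; last by rewrite linearD linearZ linearB /= mt0 mt subrr scaler0 addr0.
  by apply: symmetric_tensD => //; exact: symmetric_tensZ.
have e1 : 1 + e != 0 by rewrite gt_eqF// addr_gt0.
apply: (eF t (t0 + e *: (t0 - t)) (e / (1 + e)) Gt Ge _ _).1.
  rewrite divr_gt0 ?addr_gt0//= ltr_pdivrMr ?addr_gt0// mul1r.
  by rewrite ltrDr.
suff -> : (e / (1 + e)) *: t + (1 - e / (1 + e)) *: (t0 + e *: (t0 - t)) = t0 by [].
have -> : 1 - e / (1 + e) = (1 + e)^-1 by field.
apply: (scalerI e1); rewrite scalerDr !scalerA mulfV// mulrCA mulfV// mulr1 scale1r.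
by rewrite scalerBr addrC -addrA subrK scalerDl scale1r.
Qed.

(** A psd tensor of full image can be perturbed along every symmetric tensor in the kernel of [mu],
    so that kernel bounds the dimension from below. *)
Lemma full_rank_affdim f t0 : Gram f t0 -> limg t0 = fullv ->
  ('C(d.+2, 2) <= affdim (Gram f) + (2 * d).+1)%N.
Proof.
move=> [st0 pt0 mt0] lt0.
have := @dim_sym_kernel R V (binary_form R (2 * d)) (lin_mu R d).
rewrite !dim_forms => /leq_trans; apply; rewrite leq_add2r.
apply: affdim_ge => u /mem_sym_kernel[su mu0].
have [|e e0 pe] := psd_perturb pt0 st0 su; first by rewrite lt0 subvf.
exists e; first by rewrite gt_eqF.
exists (t0 + e *: u), t0; split=> //; last by rewrite addrAC subrr add0r.
split=> //; last by rewrite linearD linearZ /= mu0 mt0 scaler0 addr0.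
by apply: symmetric_tensD => //; exact: symmetric_tensZ.
Qed.

(** The value of [f] is a sum of real squares of values of forms spanning [limg t]. *)
Lemma Gram_feval f t a b : Gram f t ->
  feval f a b = 0 <-> forall p, p \in limg t -> feval p a b = 0.
Proof.
move=> [_ [r [p [fp tp]]] mt].
have -> : feval f a b = \sum_(i < r) (feval p`_i a b) ^+ 2.
  rewrite -mt tp linear_sum -evE linear_sum; apply: eq_bigr => i _.
  by rewrite /= evE mu_tens feval_form_mul expr2.
rewrite tp limg_psd//; split=> [s0 q qp|z].
  rewrite -evE (coord_span qp) linear_sum big1// => i _; rewrite linearZ /= evE.
  have -> : feval p`_i a b = 0.
    apply/eqP; rewrite -sqrf_eq0; apply/eqP.
    by apply: (psumr_eq0P _ s0) => // j _; rewrite sqr_ge0.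
  by rewrite scaler0.
by rewrite big1// => i _; rewrite z ?expr0n// memv_span// mem_nth// size_tuple.
Qed.

(** If [l] and [l'] vanish on [U], so does their sum; all three being evaluations, [l'] is a
    multiple of [l != 0] and cannot separate a zero of [l] from [U]. *)
Lemma evaluation_subspace (U : {vspace V}) : (3 <= d)%N -> U != fullv ->
  (forall l : 'Hom(V, R^o), (forall u, u \in U -> l u = 0) ->
     ('C(d - 1, 2) <= \dim (gram_directions l))%N) ->
  exists a b, (a, b) != (0, 0) /\ forall p, p \in U <-> feval p a b = 0.
Proof.
move=> d3 Ufull dimU.
have evU (l : 'Hom(V, R^o)) : (forall u, u \in U -> l u = 0) -> 
    evaluation_seq d (fun i => l (mono R d i) : R).
  by move=> lU; apply: large_directions_evaluation => //; exact: dimU.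
have [|v vU] := @exists_notin_vspace _ _ U.
  rewrite ltn_neqAle dimvS ?subvf// andbT; apply: contra Ufull => /eqP dU.
  by rewrite eqEdim subvf dU leqnn.
have [l [lv lU]] := separating_functional vU.
have [c [a [b [ab lE]]]] := evaluation_seqP (evU l lU).
have c0 : c != 0 by apply: contra_eq_neq lv => c0; rewrite lE c0 mul0r eq_sym oner_eq0.
exists a, b; split=> // p; split=> [pU|p0].
  by have /eqP := lU p pU; rewrite lE mulf_eq0 (negbTE c0) => /eqP.
apply: contraT => /separating_functional[l' [l'p l'U]].
have sumU u : u \in U -> (l + l') u = 0 by move=> uU; rewrite add_lfunE lU ?l'U ?addr0.
have Es : evaluation_seq d (fun i => (l (mono R d i) : R) + (l' (mono R d i) : R)).
  by have := evU _ sumU; under [X in evaluation_seq d X]eq_fun do rewrite add_lfunE.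
have [l0|[s ls]] := evaluation_seq_pencil d3 (evU l lU) (evU l' l'U) Es.
  have : l v = (0 : 'Hom(V, R^o)) v.
    by apply: mono_eq_linear => i id; rewrite /= zero_lfunE; exact: l0.
  by rewrite lv zero_lfunE => /eqP; rewrite oner_eq0.
have : l' p = (s *: l) p.
  by apply: mono_eq_linear => i id; rewrite /= scale_lfunE; exact: ls.
by rewrite l'p scale_lfunE lE p0 mulr0 scaler0 => /eqP; rewrite oner_eq0.
Qed.

Lemma large_proper_face f F : (3 <= d)%N -> F `<=` Gram f -> face_space F != fullv ->
  ('C(d - 1, 2) <= affdim F)%N ->
  exists a b, (a, b) != (0, 0) /\ forall p, p \in face_space F <-> feval p a b = 0.
Proof.
move=> d3 FG UF dF; apply: evaluation_subspace => // l lU.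
apply: leq_trans dF _; apply: affdim_le => x y Fx Fy.
(* By symmetry [k (t l) = l (t k)], and [t k] lies in the face space. *)
have z t : F t -> t l = 0.
  move=> Ft; have [/symmetric_tensP st _ _] := FG _ Ft.
  apply: functional_eq => k; rewrite linear0 st; apply: lU.
  by apply: (subvP (limg_face_space Ft)); rewrite memv_img ?memvf.
have [sx _ mx] := FG _ Fx; have [sy _ my] := FG _ Fy.
apply: mem_sym_kernel_at; first exact: symmetric_tensB.
  by rewrite linearB /lin_mu /= mx my subrr.
by rewrite add_lfunE opp_lfunE !z ?subrr.
Qed.

End Faces.

(** * Deduction of both assertions on faces *)

Theorem corollary1p10 (R : realType) (d : nat) (d_ge3 : (3 <= d)%N) :
  (forall f : binary_form R (2 * d), positive_on_P1 f ->
     forall F : set (tens2 (binary_form R d)), face (Gram f) F ->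
       face_rank F = d -> (affdim F < 'C(d - 1, 2))%N)
  /\
  (forall f : binary_form R (2 * d), nonnegative f ->
     forall F : set (tens2 (binary_form R d)), face (Gram f) F ->
       affdim F = 'C(d - 1, 2) -> F = Gram f /\ has_real_root f).
Proof.
have d0 : (0 < d)%N by apply: leq_trans d_ge3.
split=> f f0 F fF.
  move=> rF; rewrite ltnNge; apply/negP => dF.
  have [FG _ _] := fF.
  have Unfull : face_space F != fullv.
    apply: contra_eq_neq rF => UF; rewrite /face_rank UF dim_forms.
    by rewrite neq_ltn ltnSn orbT.
  have [a [b [ab Uab]]] := large_proper_face d_ge3 FG Unfull dF.
  (* The empty face has rank 0, whereas [d > 0]. *)
  have [t Ft] : exists t, F t.
    apply: contrapT => nF; move: rF; apply/eqP; rewrite neq_ltn /face_rank.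
    apply/orP; left; apply: leq_ltn_trans d0; rewrite -[X in (_ <= X)%N](dimv0 (binary_form R d)).
    by apply: dimvS; apply: face_space_le => t Ft; exfalso; apply: nF; exists t.
  have /(Gram_feval a b (FG _ Ft)) : forall p, p \in limg t -> feval p a b = 0%R.
    by move=> p pt; apply/Uab; exact: (subvP (limg_face_space Ft)).
  by move=> fab; have := f0 a b ab; rewrite fab ltxx.
move=> dF; have [FG _ _] := fF.
(* The empty set has [affdim] 0, while ['C(d - 1, 2) > 0] for [d >= 3]. *)
have [t1 Ft1] : exists t, F t.
  apply: contrapT => nF.
  have : (affdim F <= \dim (0%VS : {vspace tens2 (binary_form R d)}))%N.
    by apply: affdim_le => x y Fx; exfalso; apply: nF; exists x.
  by rewrite dF dimv0 leqn0 -leqn0 leqNgt bin_gt0; lia.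
have [t0 Ft0 lt0] := face_max_rank fF Ft1.
have [Ufull|Unfull] := eqVneq (face_space F) fullv.
  have FE : F = Gram f.
    by apply: (full_face fF Ft0) => t _; rewrite lt0 Ufull subvf.
  (* This would give [3 d <= 2 d + 1]. *)
  have := full_rank_affdim (FG _ Ft0) (etrans lt0 Ufull).
  by rewrite -FE dF bin2_gap//; lia.
have [|a [b [ab Uab]]] := large_proper_face d_ge3 FG Unfull; first by rewrite dF.
have fab : feval f a b = 0%R.
  by apply/(Gram_feval a b (FG _ Ft0)) => p; rewrite lt0 => /Uab.
split; last by exists a, b.
(* The zero of [f] forces the image of every tensor of [Gram f] into the forms vanishing there, that
   is, into [limg t0]. *)
apply: (full_face fF Ft0) => t Gt; apply/subvP => p pt; rewrite lt0; apply/Uab.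
exact: ((Gram_feval a b Gt).1 fab).
Qed.
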